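(* The variables $S$, $t=t(S)$, $l=l(S)$ uniquely determine the primitive Pythagorean triple $(x,y,a)$.
   Context: A primitive Pythagorean triple is a triple $(x,y,a)$ of positive integers with $x^2+y^2=a^2$ and $\gcd(x,y,a)=1$; by convention $x$ denotes the odd leg and $y$ the even leg. The even positive integer $S$ is the side of the so-called generating square, and it is written as $S=2tl$ with positive integers $t,l$ such that $\gcd(t,l)=1$ and $l$ is odd ($t$ may have any parity); $t(S)$ and $l(S)$ denote the two factors in such a representation of $S$. The triple constructed from these variables is $x=S+l^2$, $y=S+2t^2$, $a=S+l^2+2t^2$. *)

(* Defs.v *)
From mathcomp Require Import all_boot.

Set Implicit Arguments.
Unset Strict Implicit.
Unset Printing Implicit Defensive.

(* The convention that the first leg is the odd one is part of the notion. *)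
Definition primitive_pythagorean_triple (T : nat * nat * nat) : Prop :=
  let: (x, y, a) := T in
  [/\ [/\ 0 < x, 0 < y & 0 < a],
      x ^ 2 + y ^ 2 = a ^ 2,
      gcdn (gcdn x y) a = 1
    & odd x /\ ~~ odd y].

(* A relation, since [S] does not determine [t] and [l]: 6 is both
   2 * 1 * 3 and 2 * 3 * 1. *)
Definition square_representation (S t l : nat) : Prop :=
  [/\ 0 < S /\ ~~ odd S,
      0 < t /\ 0 < l,
      S = 2 * t * l,
      gcdn t l = 1
    & odd l].

Definition constructed_from (S t l : nat) (T : nat * nat * nat) : Prop :=
  let: (x, y, a) := T in
  [/\ x = S + l ^ 2, y = S + 2 * t ^ 2 & a = S + l ^ 2 + 2 * t ^ 2].

(* Main.v *)
Require Import Defs.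
From mathcomp Require Import all_boot.
From mathcomp Require Import zify.

(** The formulas fix every entry, so uniqueness is immediate; the content is that they give a
    primitive triple. The Pythagorean equation reduces to [S ^ 2 = 4 * t ^ 2 * l ^ 2], and
    primitivity follows from coprimality of the two legs alone. *)

(* The legs factor as [l * (2t + l)] and [2t * (l + t)]; each factor of the
   first is coprime to each factor of the second. *)
Lemma coprime_legs (t l : nat) :
  coprime t l -> odd l ->
  coprime (2 * t * l + l ^ 2) (2 * t * l + 2 * t ^ 2).
Proof.
move=> ctl lodd.
have -> : 2 * t * l + l ^ 2 = l * (2 * t + l) by nia.
have -> : 2 * t * l + 2 * t ^ 2 = 2 * t * (l + t) by nia.
have cl2t : coprime l (2 * t).
  by rewrite coprimeMr coprimen2 lodd coprime_sym.
have cl_sum : coprime l (l + t).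
  by rewrite /coprime gcdnDl -/(coprime l t) coprime_sym.
have csum_2t : coprime (2 * t + l) (2 * t).
  by rewrite coprime_sym /coprime gcdnDl gcdnC.
have csum_sum : coprime (2 * t + l) (l + t).
  (* Euclid's algorithm: removing [l + t] leaves [t], and then the gcd of [l + t] and [t] is that of
     [l] and [t]. *)
  have -> : 2 * t + l = (l + t) + t by lia.
  by rewrite coprime_sym /coprime gcdnDl gcdnC gcdnDr.
by rewrite coprimeMl !(coprimeMr _ (2 * t)) cl2t cl_sum csum_2t csum_sum.
Qed.

Theorem theorem1p1 (S t l : nat) (hS : square_representation S t l) :
  exists! T : nat * nat * nat,
    primitive_pythagorean_triple T /\ constructed_from S t l T.
Proof.
case: hS => -[S_gt0 _] _ ES /eqP ctl lodd.
exists (S + l ^ 2, S + 2 * t ^ 2, S + l ^ 2 + 2 * t ^ 2).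
split; last by move=> [[x y] a] [_ [-> -> ->]].
split=> //; split.
- by split; rewrite -?addnA addn_gt0 S_gt0.
- by rewrite ES; nia.
- by have /eqP := coprime_legs _ _ ctl lodd; rewrite -ES => ->; rewrite gcd1n.
(* Modulo 2 only [l ^ 2] survives in [x], and nothing in [y]. *)
- by rewrite ES -!mulnA !mul2n !oddD !odd_double oddX lodd.
Qed.
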